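(* Let $N>1$, let $X_1,\dots,X_N$ be real Banach spaces, $X=X_1\times\cdots\times X_N$, and for each $i\in\{1,\dots,N\}$ let $X_i^{\mathrm{ad}}\subset X_i$ be nonempty, compact and convex. Let $\mathcal{C}=X^{\mathrm{ad}}=X_1^{\mathrm{ad}}\times\cdots\times X_N^{\mathrm{ad}}$ and consider the game $G=(\mathbf{X},\mathcal{J})$ with constant constraint map $\mathbf{X}(x)\equiv X^{\mathrm{ad}}=\mathcal{C}$ and objectives $\mathcal{J}_i:X\to\mathbb{R}$, where for each $i$ the function $\mathcal{J}_i$ is continuous and continuously differentiable, with partial derivative $\partial_i\mathcal{J}_i(x)\in X_i^*$ with respect to $x_i$, and $\mathcal{J}_i(\cdot,x_{-i}):X_i\to\mathbb{R}$ is convex for every $x_{-i}\in X_{-i}$. If the game $G_r=(\mathbf{X},r\cdot\mathcal{J})$ is diagonally strictly convex on $\mathcal{C}$ for some $r=(r_1,\dots,r_N)$ with $r_i>0$ for all $i$, then the set $\mathbf{VE}(G)$ of variational equilibria of $G$ is a singleton.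
   Context: Notation: for $x\in X$, $x_{-i}$ denotes the bundle of all components of $x$ except the $i$-th, $x=(x_i,x_{-i})$ (without changing the order of components), and $X_{-i}=\prod_{j\neq i}X_j$. $X_i^*$ is the topological dual of $X_i$. $r\cdot\mathcal{J}=(r_1\mathcal{J}_1,\dots,r_N\mathcal{J}_N)$. Nikaido–Isoda function: $\Psi(x,y)=\sum_{i=1}^N\mathcal{J}_i(y_i,x_{-i})$ for $x,y\in X$. Variational equilibrium: $\overline{x}\in\mathcal{C}$ is a variational equilibrium of $G$ if $\overline{x}$ solves $\min\{\Psi(\overline{x},y): y\in\mathcal{C}\}$; equivalently (for $C^1$ objectives as here) $\sum_{i=1}^N\langle\partial_i\mathcal{J}_i(\overline{x}),y_i-\overline{x}_i\rangle_{X_i^*,X_i}\ge 0$ for all $y\in\mathcal{C}$. The set of variational equilibria of $G$ is denoted $\mathbf{VE}(G)$. Pseudogradient and diagonal strict convexity: for $r$ with positive entries, $x,h\in X$, put $d(x,r)h=\sum_{i=1}^N r_i\,\langle\partial_i\mathcal{J}_i(x),h_i\rangle_{X_i^*,X_i}$. The game $G_r$ is diagonally strictly convex on $\mathcal{C}$ if $d(x,r)(y-x)+d(y,r)(x-y)<0$ for all $x,y\in\mathcal{C}$ with $x\neq y$. *)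

(* Defs.v *)
From HB Require Import structures.
From mathcomp Require Import all_boot all_order all_algebra.
From mathcomp Require Import all_classical all_reals all_analysis.
Set Implicit Arguments.
Unset Strict Implicit.
Unset Printing Implicit Defensive.
Import Order.TTheory GRing.Theory Num.Theory.
Import numFieldNormedType.Exports.
Local Open Scope classical_set_scope.
Local Open Scope ring_scope.

(* A finite product of normed spaces, normed by the maximum of the norms of   *)
(* the components; the library only does this for pairs and matrices. The     *)
(* alias keeps the instances off the bare type [forall i, X i].               *)
Definition normed_prod (R : realType) (I : finType) (X : I -> normedModType R)
  : Type := forall i, X i.

Section normed_prod.
Context (R : realType) (I : finType) (X : I -> normedModType R).
Local Notation T := (normed_prod X).

HB.instance Definition _ := gen_eqMixin T.
HB.instance Definition _ := gen_choiceMixin T.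

Let add (x y : T) : T := fun i => x i + y i.
Let zero : T := fun i => 0.
Let opp (x : T) : T := fun i => - x i.
Let scale (a : R) (x : T) : T := fun i => a *: x i.

Fact normed_prod_addA : associative add.
Proof. by move=> x y z; apply: functional_extensionality_dep => i; exact: addrA. Qed.
Fact normed_prod_addC : commutative add.
Proof. by move=> x y; apply: functional_extensionality_dep => i; exact: addrC. Qed.
Fact normed_prod_add0 : left_id zero add.
Proof. by move=> x; apply: functional_extensionality_dep => i; exact: add0r. Qed.
Fact normed_prod_addN : left_inverse zero opp add.
Proof. by move=> x; apply: functional_extensionality_dep => i; exact: addNr. Qed.

HB.instance Definition _ := GRing.isZmodule.Build T
  normed_prod_addA normed_prod_addC normed_prod_add0 normed_prod_addN.

Fact normed_prod_scaleA a b (x : T) : scale a (scale b x) = scale (a * b) x.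
Proof. by apply: functional_extensionality_dep => i; exact: scalerA. Qed.
Fact normed_prod_scale1 : left_id 1 scale.
Proof. by move=> x; apply: functional_extensionality_dep => i; exact: scale1r. Qed.
Fact normed_prod_scaleDr : right_distributive scale +%R.
Proof. by move=> a x y; apply: functional_extensionality_dep => i; exact: scalerDr. Qed.
Fact normed_prod_scaleDl (x : T) : {morph scale^~ x : a b / a + b}.
Proof. by move=> a b; apply: functional_extensionality_dep => i; exact: scalerDl. Qed.

HB.instance Definition _ := GRing.Zmodule_isLmodule.Build R T
  normed_prod_scaleA normed_prod_scale1 normed_prod_scaleDr normed_prod_scaleDl.

Definition prod_norm (x : T) : R := \big[Num.max/0]_i `|x i|.

Fact prod_norm_ge0 (x : T) : 0 <= prod_norm x.
Proof. exact: bigmax_ge_id. Qed.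

Fact le_prod_norm (x : T) i : `|x i| <= prod_norm x.
Proof. by rewrite /prod_norm; exact: le_bigmax. Qed.

Fact prod_norm_leP (x : T) (M : R) :
  0 <= M -> (forall i, `|x i| <= M) -> prod_norm x <= M.
Proof. by move=> M0 xM; apply/bigmax_leP; split. Qed.

Fact ler_prod_normD (x y : T) : prod_norm (x + y) <= prod_norm x + prod_norm y.
Proof.
apply: prod_norm_leP => [|i]; first by rewrite addr_ge0// prod_norm_ge0.
by rewrite (le_trans (ler_normD _ _))// lerD// le_prod_norm.
Qed.

Fact prod_normZ (a : R) (x : T) : prod_norm (a *: x) = `|a| * prod_norm x.
Proof.
have le b (y : T) : prod_norm (b *: y) <= `|b| * prod_norm y.
  apply: prod_norm_leP => [|i]; first by rewrite mulr_ge0// prod_norm_ge0.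
  by rewrite [leLHS]normrZ ler_wpM2l// le_prod_norm.
apply/eqP; rewrite eq_le le/=; have [->|a0] := eqVneq a 0.
  by rewrite normr0 mul0r prod_norm_ge0.
rewrite -ler_pdivlMl ?normr_gt0// -normfV.
by rewrite (le_trans _ (le _ _))// scalerA mulVf// scale1r.
Qed.

Fact prod_norm_eq0 (x : T) : prod_norm x = 0 -> x = 0.
Proof.
move=> x0; apply: functional_extensionality_dep => i; apply/eqP.
by rewrite -normr_le0 -x0 le_prod_norm.
Qed.

HB.instance Definition _ := Lmodule_isNormed.Build R T
  ler_prod_normD prod_normZ prod_norm_eq0.

End normed_prod.

(* The derivative is continuous for the operator norm of the dual of [V].     *)
Definition continuously_differentiable (R : realType) (V : normedModType R)
    (f : V -> R) : Prop :=
  (forall x, differentiable f x) /\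
  (forall x (e : R), 0 < e -> \forall y \near x,
     forall h : V, `|'d f y h - 'd f x h| <= e * `|h|).

Section game.
Context (R : realType) (N : nat) (X : 'I_N -> normedModType R).
Local Notation XX := (normed_prod X).

(* The profile (z, x_{-i}). *)
Definition deviate (x : XX) (i : 'I_N) (z : X i) : XX :=
  @dfwith _ X x i z.

Definition strategy_set (Xad : forall i, set (X i)) : set XX :=
  [set x | forall i, Xad i (x i)].

Context (J : 'I_N -> XX -> R).

Definition nikaido_isoda (x y : XX) : R := \sum_(i < N) J i (deviate x (y i)).

Definition VE (C : set XX) : set XX :=
  [set x | C x /\ forall y, C y -> nikaido_isoda x x <= nikaido_isoda x y].

(* The partial derivative of [J i] with respect to [x i]. *)
Definition partial (i : 'I_N) (x : XX) : {linear X i -> R} :=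
  'd (fun z : X i => J i (deviate x z)) (x i).

Definition pseudogradient (x : XX) (r : 'I_N -> R) (h : XX) : R :=
  \sum_(i < N) r i * partial i x (h i).

Definition diagonally_strictly_convex (r : 'I_N -> R) (C : set XX) : Prop :=
  forall x y, C x -> C y -> x <> y ->
    pseudogradient x r (y - x) + pseudogradient y r (x - y) < 0.

End game.

(* Main.v *)
(* Since the constraint set is a product and the objectives are convex in the *)
(* own variable, the variational equilibria are the solutions x of            *)
(* d(x, r)(y - x) >= 0 for all feasible y, whatever the positive weights r.   *)
(* Diagonal strict convexity is strict monotonicity of the pseudogradient,    *)
(* hence uniqueness.  Monotonicity also gives existence without a fixed-point *)
(* theorem: by Minty's argument it suffices to find a feasible x such that    *)
(* d(y, r)(x - y) <= 0 for all feasible y, by compactness finitely many y are *)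
(* enough, and then a minimizer of a sum of squared positive parts works.     *)
Require Import Defs.
From HB Require Import structures.
From mathcomp Require Import finmap all_boot all_order all_algebra.
From mathcomp Require Import all_classical all_reals all_analysis.
From mathcomp Require Import ring lra.
Import Order.TTheory GRing.Theory Num.Theory.
Import numFieldNormedType.Exports.
Local Open Scope classical_set_scope.
Local Open Scope ring_scope.

Set Implicit Arguments.
Unset Strict Implicit.
Unset Printing Implicit Defensive.

(** Since the feasible set is a product, an equilibrium can be tested one player at a time, and
    convexity turns each test into a first-order condition. Thus [VE_strategy_setP] identifies the
    equilibria with the solutions of the variational inequality of the [r]-weighted pseudogradient.
    Two distinct solutions would make the sum in diagonal strict convexity nonnegative, a
    contradiction.

    For existence, [minty_finite] treats finitely many test points y_i: minimize over [C] the sum of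
    the squares of p_i = max(0, F(y_i)(x - y_i)). Weighting the first-order condition toward y_k by
    p_k and summing over k, monotonicity forces every p_k to vanish. Then [minty_solution] reaches
    all test points by compactness, and [stampacchia_solution] moves the operator from the test
    point to the solution along segments. *)

(** * One-sided limits, segments and convexity *)

Lemma ge0_right_limit (R : realType) (f : R -> R) (l : R) :
  f t @[t --> 0^'+] --> l -> (forall t, 0 < t <= 1 -> 0 <= f t) -> 0 <= l.
Proof.
move=> fl f0; apply: (cvgr_to_ge fl).
near=> t; apply: f0; apply/andP; split; near: t; first exact: nbhs_right_gt.
by apply: nbhs_right_le.
Unshelve. all: by end_near. Qed.

Lemma diff_right_limit (R : realType) (V : normedModType R) (f : V -> R)
    (a h : V) :
  differentiable f a ->
  t^-1 * (f (a + t *: h) - f a) @[t --> (0 : R)^'+] --> 'd f a h.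
Proof.
move=> df; rewrite -deriveE//.
have /cvg_dnbhs_at_right := @diff_derivable _ _ _ _ _ h df.
apply: cvg_trans; apply: near_eq_cvg; near=> t.
by rewrite /= (addrC a).
Unshelve. all: by end_near. Qed.

Lemma convex_set_segment (R : realType) (V : lmodType R) (C : set V)
    (x y : V) (t : R) :
  convex_set C -> C x -> C y -> 0 < t <= 1 -> C (x + t *: (y - x)).
Proof.
move=> cC Cx Cy /andP[t0 t1].
have := cC y x (Itv01 (ltW t0) t1) (mem_set Cy) (mem_set Cx).
rewrite inE; congr C.
rewrite /conv/= /unstable.onem scalerBl scale1r scalerBr.
by rewrite addrCA.
Qed.

(** By convexity, the difference quotients from [a] toward [b] are at most [f b - f a], and this
    bound survives the limit. *)
Lemma convex_function_diff (R : realType) (V : normedModType R) (f : V -> R)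
    (a b : V) : differentiable f a -> convex_function [set: V] f ->
  'd f a (b - a) <= f b - f a.
Proof.
move=> df cf; rewrite -subr_ge0.
apply: (@ge0_right_limit _
  (fun t => (f b - f a) - t^-1 * (f (a + t *: (b - a)) - f a))).
  by apply: cvgB; [exact: cvg_cst|exact: diff_right_limit].
move=> t /andP[t0 t1]; rewrite subr_ge0 ler_pdivrMl//.
have := cf (Itv01 (ltW t0) t1) b a (in_setT _) (in_setT _).
have -> : conv (Itv01 (ltW t0) t1) (b : convex_lmodType V) a = a + t *: (b - a).
  by rewrite /conv/= /unstable.onem scalerBl scale1r scalerBr addrCA.
rewrite convRE /= /unstable.onem; lra.
Qed.

Lemma ge0_of_affine (R : realType) (a b : R) :
  (forall t, 0 < t <= 1 -> 0 <= a + t * b) -> 0 <= a.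
Proof.
apply: (@ge0_right_limit _ (fun t => a + t * b)); apply: cvg_at_right_filter.
have : a + t * b @[t --> (0 : R)] --> a + 0 * b.
  by apply: cvgD; [exact: cvg_cst|exact: (cvgM cvg_id (cvg_cst b))].
by rewrite mul0r addr0.
Qed.

(** Either the left side is 0, or 0 < a + b <= max(0, a) + b. This quadratic upper bound replaces
    differentiation of the squared positive part. *)
Lemma sqr_max0D (R : realType) (a b : R) :
  Num.max 0 (a + b) ^+ 2 <= (Num.max 0 a + b) ^+ 2.
Proof. by rewrite /Num.max; case: ifP => h1; case: ifP => h2; nra. Qed.

(** * Monotone variational inequalities on a compact convex set *)

Section variational_inequality.
Context (R : realType) (V : normedModType R) (C : set V) (F : V -> {scalar V}).
Hypotheses (C0 : C !=set0) (cptC : compact C) (cvxC : convex_set C).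
Hypothesis F_continuous : forall x, continuous (F x).
Hypothesis F_monotone : forall x y,
  C x -> C y -> F x (y - x) + F y (x - y) <= 0.

Lemma minty_finite (I : finType) (y : I -> V) : (forall i, C (y i)) ->
  exists2 x, C x & forall i, F (y i) (x - y i) <= 0.
Proof.
move=> Cy; pose p i x := Num.max 0 (F (y i) (x - y i)).
have p_continuous i : continuous (p i).
  move=> x; apply: (@continuous_max _ _ (cst 0) (fun z => F (y i) (z - y i))).
    exact: cvg_cst.
  apply: (@continuous_comp _ _ _ (fun z => z - y i)); last exact: F_continuous.
  by apply: cvgB; [exact: cvg_id|exact: cvg_cst].
have f_continuous : continuous (fun x => \sum_i p i x ^+ 2).
  apply: continuous_big; first exact: add_continuous.
  by move=> i _ x; apply: (@continuousM _ _ (p i) (p i)); exact: p_continuous.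
have [x xC xmin] := compact_EVT_min C0 cptC (continuous_subspaceT f_continuous).
rewrite inE in xC; exists x => //.
(* First-order optimality of the minimizer [x] in the direction of [y k]. *)
have descent k : 0 <= \sum_i p i x * F (y i) (y k - x).
  suff : 0 <= 2 * \sum_i p i x * F (y i) (y k - x) by rewrite pmulr_rge0.
  (* Along the segment, the increase of the objective is at most t times (first-order term + t times
     this sum), by [sqr_max0D]; minimality makes it nonnegative, so t can be divided out and sent to
     0. *)
  apply: (@ge0_of_affine _ _ (\sum_i F (y i) (y k - x) ^+ 2)) => t t01.
  have [t0 _] := andP t01; rewrite -(pmulr_rge0 _ t0).
  have := xmin _ (mem_set (convex_set_segment cvxC xC (Cy k) t01)).
  rewrite -subr_ge0 -sumrB => /le_trans; apply.
  rewrite mulrDr mulrA !mulr_sumr -big_split/=; apply: ler_sum => i _.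
  rewrite /p [x + _ - _]addrAC linearD linearZ/= lerBlDr.
  apply: le_trans (sqr_max0D _ _) _; rewrite le_eqVlt; apply/orP; left.
  by apply/eqP; ring.
(* Swapping [i] and [k] and averaging brings in monotonicity. *)
have sum_p : \sum_k p k x * \sum_i p i x * F (y i) (y k - y i) <= 0.
  set S := (X in X <= 0).
  suff : S + S <= 0 by lra.
  have {2}-> : S = \sum_k p k x * \sum_i p i x * F (y k) (y i - y k).
    rewrite /S; under eq_bigr do rewrite mulr_sumr.
    rewrite exchange_big/=; apply: eq_bigr => k _; rewrite mulr_sumr.
    by apply: eq_bigr => i _; ring.
  rewrite -big_split/=; apply: sumr_le0 => k _.
  rewrite -mulrDr -big_split/=; apply: mulr_ge0_le0.
    by rewrite le_max lexx.
  apply: sumr_le0 => i _; rewrite -mulrDr.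
  by apply: mulr_ge0_le0; [rewrite le_max lexx|exact: F_monotone].
(* A positive part is either 0 or equal to the value itself. *)
have pF i : p i x * F (y i) (x - y i) = p i x ^+ 2.
  by rewrite /p /Num.max; case: ifP => _; rewrite ?mul0r ?expr0n//= expr2.
have p0 k : p k x = 0.
  (* Splitting y_j - y_i as (y_j - x) + (x - y_i), [descent] and [pF] bound the sum of squares by
     the inner sum of [sum_p] for every j. *)
  have pk_le0 : p k x * \sum_i p i x ^+ 2 <= 0.
    apply: (@le_trans _ _ (\sum_k p k x * \sum_i p i x ^+ 2)).
      rewrite [leRHS](bigD1 k)//= lerDl sumr_ge0// => i _.
      by rewrite mulr_ge0 ?le_max ?lexx// sumr_ge0// => j _; rewrite sqr_ge0.
    apply: le_trans sum_p; apply: ler_sum => j _.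
    apply: ler_wpM2l; first by rewrite le_max lexx.
    rewrite -[leLHS]add0r; under [leRHS]eq_bigr => i _.
      rewrite -[y j](subrK x) -addrA linearD mulrDr pF.
      over.
    by rewrite big_split/= lerD2r.
  apply/eqP; rewrite eq_le [0 <= _]le_max lexx andbT leNgt; apply/negP => pk.
  move: pk_le0; rewrite pmulr_rle0// leNgt => /negP; apply.
  rewrite (bigD1 k)//=; apply: ltr_wpDr; last exact: exprn_gt0.
  by apply: sumr_ge0 => j _; exact: sqr_ge0.
by move=> i; rewrite -(p0 i) le_max lexx orbT.
Qed.

(** Each test point cuts out a relatively closed subset of [C]; [minty_finite] is the finite
    intersection property of this family. *)
Lemma minty_solution : exists2 x, C x & forall y, C y -> F y (x - y) <= 0.
Proof.
move: (cptC); rewrite compact_In0.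
move=> /(_ V C (fun y => C `&` [set x | F y (x - y) <= 0])) [].
- exists (fun y => [set x | F y (x - y) <= 0]) => // y _.
  apply: (@preimage_closed _ _ (fun x => F y (x - y)) [set r | r <= 0]);
    last exact: closed_le.
  move=> x _; apply: (@continuous_comp _ _ _ (fun z => z - y)).
    by apply: cvgB; [exact: cvg_id|exact: cvg_cst].
  exact: F_continuous.
- move=> D DC; have [i|x Cx Fx] := @minty_finite D val.
    by have := DC (val i) (valP i); rewrite inE.
  by exists x => y yD; split => //; exact: (Fx [` yD]%fset).
(* The intersection runs over test points in [C], so [x] is known to lie in [C] only because there
   is at least one. *)
- move=> x Hx; have [y Cy] := C0; exists x; first by have [] := Hx y Cy.
  by move=> z Cz; have [] := Hx z Cz.
Qed.

Hypothesis F_hemicontinuous : forall x h v,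
  F (x + t *: h) v @[t --> (0 : R)] --> F x v.

(** Minty's trick: test at z = x + t(y - x). Since x - z = -t(y - x), dividing by t > 0 gives F z (y
    - x) >= 0, and t tends to 0. *)
Lemma stampacchia_solution :
  exists2 x, C x & forall y, C y -> 0 <= F x (y - x).
Proof.
have [x Cx Fx] := minty_solution; exists x => // y Cy.
apply: (@ge0_right_limit _ (fun t => F (x + t *: (y - x)) (y - x))).
  apply: cvg_at_right_filter; exact: F_hemicontinuous.
move=> t t01; have [t0 _] := andP t01.
have := Fx _ (convex_set_segment cvxC Cx Cy t01).
by rewrite opprD addNKr linearN linearZ/= oppr_le0 pmulr_rge0.
Qed.

End variational_inequality.

(** * Compactness in the product norm *)

(** Tychonoff gives compactness in the product topology. The identity [g] to the max norm is
    continuous because finitely many coordinate conditions can be met at once. *)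
Lemma normed_prod_compact (R : realType) (I : finType)
    (X : I -> normedModType R) (A : forall i, set (X i)) :
  (forall i, compact (A i)) ->
  compact [set x : normed_prod X | forall i, A i (x i)].
Proof.
move=> cA; pose g (f : prod_topology X) : normed_prod X := f.
have -> : [set x : normed_prod X | forall i, A i (x i)] =
    g @` [set f | forall i, A i (f i)].
  by rewrite image_id.
apply: (@continuous_compact (prod_topology X) (normed_prod X) g); last first.
  exact: (@tychonoff I X A).
apply: continuous_subspaceT => f; move: (f : prod_topology X) => {}f.
have FF : Filter (nbhs (f : prod_topology X)) by exact: nbhs_filter.
apply/(@cvgrPdist_le _ _ _ _ FF) => e e0.
have near_proj i : \forall h \near (f : prod_topology X), `|f i - h i| <= e.
  have /cvgrPdist_le/(_ e e0) := @proj_continuous I X i f.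
  exact.
apply: (@filterS _ _ FF _ _ _ (filter_forall FF near_proj)) => h fh.
by apply: prod_norm_leP; [exact: ltW|exact: fh].
Qed.

(** * Partial derivatives, the pseudogradient and equilibria *)

Section game.
Context (R : realType) (N : nat) (X : 'I_N -> normedModType R).
Local Notation XX := (normed_prod X).
Implicit Types (x y h : XX) (i : 'I_N).

Lemma deviate_in x i (z : X i) : deviate x z i = z.
Proof. exact: dfwithin. Qed.

Lemma deviate_out x i j (z : X i) : i != j -> deviate x z j = x j.
Proof. exact: dfwithout. Qed.

Lemma deviate_id x i : deviate x (x i) = x.
Proof.
apply: functional_extensionality_dep => j.
by rewrite /deviate; case: dfwithP.
Qed.

Definition injection i (z : X i) : XX := deviate 0 z.

Lemma coordD x y i : (x + y) i = x i + y i. Proof. by []. Qed.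

Lemma coordB x y i : (x - y) i = x i - y i. Proof. by []. Qed.

Lemma coordZ (a : R) x i : (a *: x) i = a *: x i. Proof. by []. Qed.

(** Exhibits a deviation as an affine map of [z] with linear part [injection], so that partial
    derivatives follow from the chain rule. *)
Lemma deviateE x i (z : X i) : deviate x z = injection (z - x i) + x.
Proof.
apply: functional_extensionality_dep => j; rewrite coordD /injection.
have [<-|ij] := eqVneq i j; first by rewrite !deviate_in subrK.
by rewrite !deviate_out// add0r.
Qed.

Lemma injection_is_linear i : linear (@injection i).
Proof.
move=> a u v; apply: functional_extensionality_dep => j.
rewrite coordD coordZ /injection.
have [<-|ij] := eqVneq i j; first by rewrite !deviate_in.
by rewrite !deviate_out// addr0 scaler0.
Qed.

HB.instance Definition _ i := GRing.isLinear.Build R (X i) XX *:%R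
  (@injection i) (@injection_is_linear i).

Lemma ler_norm_injection i (z : X i) : `|injection z| <= `|z|.
Proof.
apply: prod_norm_leP => // j; rewrite /injection.
have [<-|ij] := eqVneq i j; first by rewrite deviate_in.
by rewrite deviate_out// normr0.
Qed.

Lemma injection_continuous i : continuous (@injection i).
Proof.
move=> z; apply/cvgrPdist_le => e e0; near=> w.
rewrite -linearB; apply: le_trans (ler_norm_injection _) _.
by near: w; exact: cvgr_dist_le.
Unshelve. all: by end_near. Qed.

Lemma coord_prod_continuous i : continuous (fun x : XX => x i).
Proof.
move=> x; apply/(@cvgrPdist_le _ _ _ _ (nbhs_filter x)) => e e0; near=> y.
apply: (@le_trans _ _ `|x - y|); first exact: (@le_prod_norm _ _ _ (x - y) i).
by near: y; exact: cvgr_dist_le.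
Unshelve. all: by end_near. Qed.

Lemma is_diff_deviate x i (z : X i) :
  is_diff z (fun u : X i => deviate x u) (@injection i).
Proof.
have -> : (fun u : X i => deviate x u) =
    cst (x - injection (x i)) + @injection i.
  apply/funext => u; rewrite deviateE linearB/=.
  rewrite -[RHS]/(x - injection (x i) + injection u).
  by rewrite [RHS]addrC addrA addrAC.
have di : is_diff z (@injection i) (@injection i).
  apply: DiffDef; last by rewrite diff_lin//; exact: injection_continuous.
  by apply: linear_differentiable; exact: injection_continuous.
by apply: is_diff_eq; rewrite add0r.
Qed.

Context (J : 'I_N -> XX -> R).
Hypothesis J_C1 : forall i, continuously_differentiable (J i).

Lemma differentiable_deviate x i (z : X i) :
  differentiable (fun u : X i => J i (deviate x u)) z.
Proof.
have dd := is_diff_deviate x z.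
apply: (@differentiable_comp _ _ _ _ (fun u : X i => deviate x u) (J i)) => //.
by have [+ _] := J_C1 i; exact.
Qed.

(** Transfers the continuity of the full derivative of [J i] to its partial derivative. *)
Lemma partialE x i (v : X i) : partial J i x v = 'd (J i) x (injection v).
Proof.
have dd := is_diff_deviate x (x i).
have [dJ _] := J_C1 i.
rewrite /partial (@diff_comp _ _ _ _ (fun u : X i => deviate x u) (J i))//=.
by rewrite diff_val deviate_id.
Qed.

Lemma partial_hemicontinuous x h i (v : X i) :
  partial J i (x + t *: h) v @[t --> (0 : R)] --> partial J i x v.
Proof.
rewrite partialE; under eq_fun do rewrite partialE.
apply: (@cvg_comp _ _ _ (fun t : R => x + t *: h)
  (fun y => 'd (J i) y (injection v)) _ (nbhs x)).
  have : x + t *: h @[t --> (0 : R)] --> x + 0 *: h.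
    by apply: cvgD; [exact: cvg_cst|apply: cvgZ; [exact: cvg_id|exact: cvg_cst]].
  by rewrite scale0r addr0.
apply/(@cvgrPdist_le _ _ _ _ (nbhs_filter x)) => e e0.
have [_ cJ] := J_C1 i.
(* Adding 1 keeps the divisor positive when the direction is zero. *)
have v0 : 0 < `|injection v| + 1 by rewrite ltr_wpDl.
have := cJ x (e / (`|injection v| + 1)) (divr_gt0 e0 v0).
apply: filterS => y /(_ (injection v)); rewrite distrC => /le_trans; apply.
rewrite -mulrA ler_piMr ?(ltW e0)// ler_pdivrMl// mulr1.
by rewrite lerDl.
Qed.

Lemma pseudogradient_is_scalar x (r : 'I_N -> R) :
  scalar (pseudogradient J x r).
Proof.
move=> a u v; rewrite /pseudogradient mulr_sumr -big_split/=.
apply: eq_bigr => i _; rewrite coordD coordZ linearP/= mulrDr.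
by congr (_ + _); exact: mulrCA.
Qed.

HB.instance Definition _ x r := GRing.isLinear.Build R XX R *%R
  (pseudogradient J x r) (@pseudogradient_is_scalar x r).

Lemma pseudogradient_continuous x (r : 'I_N -> R) :
  continuous (pseudogradient J x r).
Proof.
apply: continuous_big; first exact: add_continuous.
move=> i _ h.
apply: (@continuousM _ _ (cst (r i)) (fun y : XX => partial J i x (y i))).
  exact: cst_continuous.
apply: (@continuous_comp _ _ _ (fun y : XX => y i) (partial J i x)).
  exact: coord_prod_continuous.
exact/diff_continuous/differentiable_deviate.
Qed.

Lemma pseudogradient_hemicontinuous x h v (r : 'I_N -> R) :
  pseudogradient J (x + t *: h) r v @[t --> (0 : R)] --> pseudogradient J x r v.
Proof.
apply: cvg_big; first exact: add_continuous.
move=> i _; apply: (@cvgM _ _ _ _ (cst (r i))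
  (fun t => partial J i (x + t *: h) (v i))).
  exact: cvg_cst.
exact: partial_hemicontinuous.
Qed.

Lemma pseudogradient_deviate x i (z : X i) (r : 'I_N -> R) :
  pseudogradient J x r (deviate x z - x) = r i * partial J i x (z - x i).
Proof.
rewrite /pseudogradient (bigD1 i)//= coordB deviate_in big1 ?addr0// => j ji.
by rewrite coordB deviate_out 1?eq_sym// subrr linear0 mulr0.
Qed.

Hypothesis J_convex : forall i x,
  convex_function [set: X i] (fun z : X i => J i (deviate x z)).

Lemma strategy_set_deviate (Xad : forall i, set (X i)) x i (z : X i) :
  strategy_set Xad x -> Xad i z -> strategy_set Xad (deviate x z).
Proof.
move=> Cx Az j; have [<-|ij] := eqVneq i j; first by rewrite deviate_in.
by rewrite deviate_out.
Qed.

(** Unilateral deviations stay feasible in a product, so both conditions split into one inequality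
    per player, and positive weights do not affect its sign. Minimality gives the derivative
    inequality by one-sided limits; convexity gives the converse. *)
Lemma VE_strategy_setP (Xad : forall i, set (X i)) (r : 'I_N -> R) x :
  (forall i, convex_set (Xad i)) -> (forall i, 0 < r i) ->
  VE J (strategy_set Xad) x <-> strategy_set Xad x /\
    forall y, strategy_set Xad y -> 0 <= pseudogradient J x r (y - x).
Proof.
move=> cvxA r0; split=> [[Cx xmin]|[Cx xVI]]; split => // y Cy.
  apply: sumr_ge0 => i _; apply: mulr_ge0; first exact/ltW.
  rewrite coordB.
  have := diff_right_limit (h := y i - x i) (differentiable_deviate x (x i)).
  move=> /ge0_right_limit; apply.
  move=> t t01; have [t0 _] := andP t01.
  rewrite mulr_ge0// ?invr_ge0 ?(ltW t0)// deviate_id subr_ge0.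
  (* Only component [i] moves, so the terms of all other players cancel in the comparison. *)
  have Az := convex_set_segment (cvxA i) (Cx i) (Cy i) t01.
  have := xmin _ (strategy_set_deviate Cx Az).
  rewrite /nikaido_isoda (bigD1 i)//= [leRHS](bigD1 i)//= deviate_in deviate_id.
  under [X in _ <= _ + X]eq_bigr => j ji do rewrite deviate_out 1?eq_sym//.
  by rewrite lerD2r.
apply: ler_sum => i _; rewrite deviate_id -subr_ge0.
have := convex_function_diff (y i) (differentiable_deviate x (x i))
  (@J_convex i x).
rewrite deviate_id; apply: le_trans; rewrite -(pmulr_rge0 _ (r0 i)).
have := xVI _ (strategy_set_deviate Cx (Cy i)).
by rewrite pseudogradient_deviate.
Qed.
End game.

Theorem proposition4p5 (R : realType) (N : nat) (hN : (1 < N)%N)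
    (X : 'I_N -> completeNormedModType R)
    (Xad : forall i : 'I_N, set (X i))
    (Xad_nonempty : forall i : 'I_N, Xad i !=set0)
    (Xad_compact : forall i : 'I_N, compact (Xad i))
    (Xad_convex : forall i : 'I_N, convex_set (Xad i))
    (J : 'I_N -> normed_prod X -> R)
    (J_continuous : forall i : 'I_N, continuous (J i))
    (J_C1 : forall i : 'I_N, continuously_differentiable (J i))
    (J_convex : forall (i : 'I_N) (x : normed_prod X),
        convex_function [set: X i] (fun z : X i => J i (deviate x z)))
    (J_dsc : exists r : 'I_N -> R, (forall i : 'I_N, 0 < r i) /\
        diagonally_strictly_convex J r (strategy_set Xad)) :
  exists x : normed_prod X, VE J (strategy_set Xad) = [set x].
Proof.
have [r [r0 dsc]] := J_dsc.
have VEP x := VE_strategy_setP J_C1 J_convex x Xad_convex r0.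
have C0 : strategy_set Xad !=set0.
  by exists (fun i => projT1 (cid (Xad_nonempty i))) => i; exact: projT2 (cid _).
have cptC : compact (strategy_set Xad) by exact: normed_prod_compact.
have cvxC : convex_set (strategy_set Xad).
  move=> x y t /set_mem Cx /set_mem Cy; apply/mem_set => i.
  by have := Xad_convex i _ _ t (mem_set (Cx i)) (mem_set (Cy i)); rewrite inE.
have mono x y : strategy_set Xad x -> strategy_set Xad y ->
    pseudogradient J x r (y - x) + pseudogradient J y r (x - y) <= 0.
  move=> Cx Cy; have [->|/eqP xy] := eqVneq x y; last exact/ltW/dsc.
  by rewrite subrr linear0 addr0.
have [x Cx xVI] := @stampacchia_solution _ _ _
  (fun x => pseudogradient J x r : {scalar _}) C0 cptC cvxC
  (fun x => pseudogradient_continuous J_C1 (x := x) (r := r)) mono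
  (fun x h v => @pseudogradient_hemicontinuous _ _ _ _ J_C1 x h v r).
exists x; apply/seteqP; split=> [y /VEP[Cy yVI]|_ ->]; last exact/VEP.
(* If [y] differed from [x], the two variational inequalities, each tested at the other solution,
   would add up to a nonnegative sum that must be negative. *)
apply: contrapT => yx; have := dsc _ _ Cy Cx yx.
by rewrite ltNge addr_ge0 ?xVI ?yVI.
Qed.
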